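(* Let $\nu$ be a valuation on $K[x]$ and let $\mu$ be an extension of $\nu$ to $\overline K[x]$. Let $\Lambda$ be a complete sequence of key polynomials for $\nu$, without last element. For each $Q\in\Lambda$, let $a_Q\in\overline K$ be a root of $Q$ such that $\mu(x-a_Q)=\delta(Q)$. Then $\{a_Q\}_{Q\in\Lambda}$ is a pseudo-convergent sequence of transcendental type (for the valued field $(\overline K,\mu|_{\overline K})$), without a limit in $\overline K$, such that $x$ is a limit for it (with respect to $\mu$).
   Context: Setting: $K$ is a field, $\overline K$ a fixed algebraic closure of $K$, and $\nu:K[x]\to\Gamma\cup\{\infty\}$ is a valuation with $\Gamma$ a totally ordered abelian group, i.e. $\nu(fg)=\nu(f)+\nu(g)$, $\nu(f+g)\ge\min\{\nu(f),\nu(g)\}$, $\nu(1)=0$, $\nu(0)=\infty$. It is assumed that the support of $\nu$ is zero, i.e. $\nu(f)=\infty$ only for $f=0$. $\mu$ is a valuation on $\overline K[x]$ with $\mu|_{K[x]}=\nu$. Quotients of values by positive integers are taken in the divisible hull of the value group. $\delta$: for a monic nonconstant $f\in K[x]$, $\delta(f):=\max\{\mu(x-a)\mid a\in\overline K \text{ is a root of } f\}$. Formal derivatives: for $f\in K[x]$ and $r\ge 0$, $\partial_r f\in K[x]$ is the uniquely determined polynomial such that $f(x+y)=\sum_{i=0}^{\deg f}\partial_i f(x)\,y^i$ with $y$ an independent variable ($\partial_r f=0$ for $r>\deg f$). Level: for nonzero $f\in K[x]$, $\epsilon(f):=\max_{r\ge 1}\left\{\frac{\nu(f)-\nu(\partial_r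 f)}{r}\right\}$, where terms with $\partial_r f=0$ are read as $-\infty$ (so $\epsilon(f)=-\infty$ for $f$ a nonzero constant). Key polynomial: a monic nonconstant $Q\in K[x]$ is a key polynomial for $\nu$ if for every nonzero $f\in K[x]$, $\epsilon(f)\ge\epsilon(Q)$ implies $\deg(f)\ge\deg(Q)$. Truncation: for a nonconstant $q\in K[x]$, every $p\in K[x]$ has a unique $q$-expansion $p=p_0+p_1q+\cdots+p_nq^n$ with each $p_i\in K[x]$ zero or of degree $<\deg(q)$; the $q$-truncation of $\nu$ is $\nu_q(p):=\min_{0\le i\le n}\{\nu(p_iq^i)\}$. Complete sequence: a set $\Lambda$ of key polynomials for $\nu$ with $\epsilon(Q)\ne\epsilon(Q')$ for distinct $Q,Q'\in\Lambda$ is a complete sequence of key polynomials for $\nu$ if it is well-ordered by the order $Q<Q'\iff\epsilon(Q)<\epsilon(Q')$ and for every $f\in K[x]$ there exists $Q\in\Lambda$ such that $\nu_Q(f)=\nu(f)$. Pseudo-convergent sequences: for a valued field $(L,\mu)$, a family $\{a_\rho\}$ of elements of $L$ indexed by a well-ordered set without last element is pseudo-convergent if $\mu(a_\sigma-a_\rho)<\mu(a_\tau-a_\sigma)$ for all indices $\rho<\sigma<\tau$. An element $a$ (of $L$, or of $L[x]$ when $\mu$ is defined on $L[x]$) is a limit of $\{a_\rho\}$ if $\mu(a-a_\rho)=\mu(a_{\rho+1}-a_\rho)$ for every $\rho$, where $\rho+1$ is the immediate successor of $\rho$. The sequence is of transcendental type if for every $f(x)\in L[x]$ there is an index $\rho_f$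 such that $\mu(f(a_\sigma))=\mu(f(a_{\rho_f}))$ for every $\sigma\ge\rho_f$. Here $L=\overline K$ and the index set is $\Lambda$ with its order. *)

(* Defs.v *)
From HB Require Import structures.
From mathcomp Require Import all_boot all_order all_algebra.
From mathcomp Require Import zify.

Set Implicit Arguments.
Unset Strict Implicit.
Unset Printing Implicit Defensive.

Import Order.TTheory GRing.Theory.
Local Open Scope ring_scope.
Local Open Scope quotient_scope.

HB.mixin Record isOrderedGroup G of Num.POrderedZmodule G := {
  og_total : total (<=%R : rel G);
  og_lerD2l : forall z x y : G, x <= y -> z + x <= z + y }.

#[short(type="oGroupType")]
HB.structure Definition OrderedGroup :=
  { G of Num.POrderedZmodule G & isOrderedGroup G }.

Section OrderedGroupTheory.
Variable G : oGroupType.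
Implicit Types (x y z : G) (n : nat).

Lemma og_leP x y :
  Order.le_xor_gt x y (Order.min y x) (Order.min x y)
    (Order.max y x) (Order.max x y) (x <= y) (y < x).
Proof. exact/comparable_leP/og_total. Qed.

Lemma og_leD2l z x y : (z + x <= z + y) = (x <= y).
Proof.
apply/idP/idP => [|/(@og_lerD2l G)]; last exact.
by move=> /(@og_lerD2l G (- z)); rewrite !addKr.
Qed.

Lemma og_leD x y z t : x <= y -> z <= t -> x + z <= y + t.
Proof.
move=> xy zt; apply: (le_trans (y := x + t)); first by rewrite og_leD2l.
by rewrite ![_ + t]addrC og_leD2l.
Qed.

Lemma og_leMn n x y : x <= y -> x *+ n <= y *+ n.
Proof. by move=> xy; elim: n => [|n IH] //; rewrite !mulrS og_leD. Qed.

Lemma og_leMn2r n x y : (x *+ n.+1 <= y *+ n.+1) = (x <= y).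
Proof.
apply/idP/idP; last exact: og_leMn.
case: (og_leP x y) => // yx le_xy.
have: x <= y; last by move=> /(lt_le_trans yx); rewrite ltxx.
rewrite -(og_leD2l (x *+ n)) -mulrSr (le_trans le_xy) // mulrSr.
by rewrite ![_ + y]addrC og_leD2l og_leMn // ltW.
Qed.

Lemma og_mulrI n : injective (fun x : G => x *+ n.+1).
Proof.
by move=> x y /= e; apply/le_anti; rewrite -[x <= y](og_leMn2r n) -[y <= x](og_leMn2r n) e lexx.
Qed.

End OrderedGroupTheory.

Section DivisibleHull.
Variable G : oGroupType.
Implicit Types (p q r : G * nat) (x y : G) (m n : nat).

(* The pair (x, n) stands for the quotient x / (n + 1). *)
Definition dh_eq p q := p.1 *+ q.2.+1 == q.1 *+ p.2.+1.

Fact dh_eq_refl : reflexive dh_eq. Proof. by move=> p; rewrite /dh_eq. Qed.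

Fact dh_eq_sym : symmetric dh_eq.
Proof. by move=> p q; rewrite /dh_eq eq_sym. Qed.

Fact dh_eq_trans : transitive dh_eq.
Proof.
move=> q p r; rewrite /dh_eq => /eqP pq /eqP qr; apply/eqP.
apply: (@og_mulrI _ q.2) => /=.
by rewrite mulrnAC pq mulrnAC qr mulrnAC.
Qed.

Canonical dh_equiv := EquivRel dh_eq dh_eq_refl dh_eq_sym dh_eq_trans.

Definition divHull := {eq_quot dh_equiv}.

HB.instance Definition _ := EqQuotient.on divHull.
HB.instance Definition _ := Choice.on divHull.

(* [divq x n] is the quotient x / n, for 0 < n. *)
Definition divq (x : G) (n : nat) : divHull := \pi_divHull (x, n.-1).

Lemma divHullP (d : divHull) : exists x n, d = divq x n.+1.
Proof.
by exists (repr d).1, (repr d).2; rewrite /divq /= -surjective_pairing reprK.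
Qed.

Lemma divq_eqE x y m n :
  (0 < m)%N -> (0 < n)%N -> (divq x m == divq y n) = (x *+ n == y *+ m).
Proof. by case: m n => [|m] [|n] // _ _; rewrite /divq /= eqmodE. Qed.

Lemma repr_divq x n :
  (repr (divq x n.+1)).1 *+ n.+1 = x *+ (repr (divq x n.+1)).2.+1.
Proof.
have [a [i e]] : exists a i, repr (divq x n.+1) = (a, i).
  by case: (repr _) => a i; exists a, i.
have : divq a i.+1 == divq x n.+1.
  by rewrite /divq /= -e reprK.
by rewrite divq_eqE // e => /eqP.
Qed.

Definition dh_le (d e : divHull) : bool :=
  (repr d).1 *+ (repr e).2.+1 <= (repr e).1 *+ (repr d).2.+1.

Definition dh_add (d e : divHull) : divHull :=
  divq ((repr d).1 *+ (repr e).2.+1 + (repr e).1 *+ (repr d).2.+1)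
    ((repr d).2.+1 * (repr e).2.+1).

Definition dh_opp (d : divHull) : divHull := divq (- (repr d).1) (repr d).2.+1.

Fact dh_leE x y m n : (0 < m)%N -> (0 < n)%N ->
  dh_le (divq x m) (divq y n) = (x *+ n <= y *+ m).
Proof.
case: m n => [|m] [|n] // _ _.
rewrite /dh_le; have := repr_divq x m; have := repr_divq y n.
move: (repr (divq x _)) (repr (divq y _)) => [a i] [b j] /= eb ea.
rewrite -(og_leMn2r m) -[LHS](og_leMn2r n).
rewrite [a *+ _ *+ _]mulrnAC ea [b *+ _ *+ _ *+ _]mulrnAC.
rewrite [b *+ _ *+ _]mulrnAC eb.
have -> : x *+ i.+1 *+ j.+1 *+ n.+1 = x *+ n.+1 *+ j.+1 *+ i.+1.
  by rewrite -!mulrnA; congr (_ *+ _); lia.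
have -> : y *+ j.+1 *+ i.+1 *+ m.+1 = y *+ m.+1 *+ j.+1 *+ i.+1.
  by rewrite -!mulrnA; congr (_ *+ _); lia.
by rewrite !og_leMn2r.
Qed.

Fact dh_addE x y m n : (0 < m)%N -> (0 < n)%N ->
  dh_add (divq x m) (divq y n) = divq (x *+ n + y *+ m) (m * n).
Proof.
case: m n => [|m] [|n] // _ _.
rewrite /dh_add; have := repr_divq x m; have := repr_divq y n.
move: (repr (divq x _)) (repr (divq y _)) => [a i] [b j] /= eb ea.
apply/eqP; rewrite divq_eqE // !mulrnDl; apply/eqP.
congr (_ + _).
  transitivity (a *+ m.+1 *+ (j.+1 * n.+1)); last rewrite ea.
    by rewrite -!mulrnA; congr (_ *+ _); lia.
  by rewrite -!mulrnA; congr (_ *+ _); lia.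
transitivity (b *+ n.+1 *+ (i.+1 * m.+1)); last rewrite eb.
  by rewrite -!mulrnA; congr (_ *+ _); lia.
by rewrite -!mulrnA; congr (_ *+ _); lia.
Qed.

Fact dh_oppE x n : dh_opp (divq x n.+1) = divq (- x) n.+1.
Proof.
rewrite /dh_opp; have := repr_divq x n; move: (repr _) => [a i] /= e.
by apply/eqP; rewrite divq_eqE // !mulNrn e.
Qed.

Fact dh_le_refl : reflexive dh_le. Proof. by move=> d; rewrite /dh_le. Qed.

Fact dh_le_anti : antisymmetric dh_le.
Proof.
move=> d e; have [x [m ->]] := divHullP d; have [y [n ->]] := divHullP e.
by rewrite !dh_leE // => /le_anti xy; apply/eqP; rewrite divq_eqE // xy.
Qed.

Fact dh_le_trans : transitive dh_le.
Proof.
move=> e d f; have [x [m ->]] := divHullP d; have [y [n ->]] := divHullP e.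
have [z [k ->]] := divHullP f; rewrite !dh_leE // => xy yz.
rewrite -(og_leMn2r n) mulrnAC (le_trans (og_leMn _ xy)) //.
by rewrite mulrnAC [z *+ _ *+ _]mulrnAC og_leMn2r.
Qed.

Fact dh_addA : associative dh_add.
Proof.
move=> d e f; have [x [m ->]] := divHullP d; have [y [n ->]] := divHullP e.
have [z [k ->]] := divHullP f; rewrite !dh_addE //.
apply/eqP; rewrite divq_eqE // !mulrnDl -!mulrnA addrA; apply/eqP.
by congr (_ *+ _ + _ *+ _ + _ *+ _); lia.
Qed.

Fact dh_addC : commutative dh_add.
Proof.
move=> d e; have [x [m ->]] := divHullP d; have [y [n ->]] := divHullP e.
by rewrite !dh_addE // mulnC addrC.
Qed.

Fact dh_add0 : left_id (divq 0 1) dh_add.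
Proof.
move=> d; have [x [m ->]] := divHullP d.
by rewrite dh_addE // mul0rn add0r mul1n.
Qed.

Fact dh_addN : left_inverse (divq 0 1) dh_opp dh_add.
Proof.
move=> d; have [x [m ->]] := divHullP d; rewrite dh_oppE dh_addE //.
by apply/eqP; rewrite mulNrn addNr divq_eqE // !mul0rn.
Qed.

HB.instance Definition _ :=
  GRing.isZmodule.Build divHull dh_addA dh_addC dh_add0 dh_addN.
HB.instance Definition _ := Order.Le_isPOrder.Build ring_display divHull
  dh_le_refl dh_le_anti dh_le_trans.

Fact dh_total : total (<=%R : rel divHull).
Proof.
move=> d e; have [x [m ->]] := divHullP d; have [y [n ->]] := divHullP e.
by rewrite /Order.le /= !dh_leE //; apply: og_total.
Qed.

Fact dh_leD2l (z x y : divHull) : x <= y -> z + x <= z + y.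
Proof.
have [a [i ->]] := divHullP x; have [b [j ->]] := divHullP y.
have [c [k ->]] := divHullP z.
rewrite /Order.le /GRing.add /= !dh_addE // !dh_leE // !mulrnDl => le_ab.
rewrite (_ : _ *+ _ *+ _ = c *+ j.+1 *+ (k.+1 * i.+1)); last first.
  by rewrite -!mulrnA; congr (_ *+ _); lia.
rewrite og_leD2l.
rewrite (_ : a *+ _ *+ _ = a *+ j.+1 *+ (k.+1 * k.+1)); last first.
  by rewrite -!mulrnA; congr (_ *+ _); lia.
rewrite (_ : b *+ _ *+ _ = b *+ i.+1 *+ (k.+1 * k.+1)); last first.
  by rewrite -!mulrnA; congr (_ *+ _); lia.
exact: og_leMn.
Qed.

HB.instance Definition _ := isOrderedGroup.Build divHull dh_total dh_leD2l.

Lemma divq_leE x y m n : (0 < m)%N -> (0 < n)%N ->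
  (divq x m <= divq y n) = (x *+ n <= y *+ m).
Proof. exact: dh_leE. Qed.

Lemma divqMn x n : (0 < n)%N -> divq x n *+ n = divq x 1.
Proof.
case: n => // n _; suff H k : divq x n.+1 *+ k = divq (x *+ k) n.+1.
  by apply/eqP; rewrite H divq_eqE //.
elim: k => [|k IH].
  by apply/eqP; rewrite /GRing.zero /= divq_eqE // !mul0rn.
rewrite mulrS IH /GRing.add /= dh_addE //; apply/eqP.
rewrite divq_eqE // -mulrnDl -mulrS -!mulrnA; apply/eqP.
by congr (_ *+ _); lia.
Qed.

Lemma divqD x y : divq (x + y) 1 = divq x 1 + divq y 1.
Proof. by rewrite [RHS]dh_addE. Qed.

Lemma divHull_divisible (d : divHull) n : exists e : divHull, e *+ n.+1 = d.
Proof.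
have [x [m ->]] := divHullP d; exists (divq x (m.+1 * n.+1)).
apply: (@og_mulrI _ m); rewrite divqMn //= -mulrnA mulnC.
exact: divqMn.
Qed.

End DivisibleHull.
Arguments divq {G} x n.

Variant withTop (T : Type) := Fin of T | Infty.
Arguments Infty {T}.

Definition withTop_map (T T' : Type) (j : T -> T') (u : withTop T) : withTop T'
  := if u is Fin x then Fin (j x) else Infty.

Section WithTop.

Definition withTop_option T (u : withTop T) : option T :=
  if u is Fin x then Some x else None.
Definition option_withTop T (u : option T) : withTop T :=
  if u is Some x then Fin x else Infty.
Fact withTop_optionK T : cancel (@withTop_option T) (@option_withTop T).
Proof. by case. Qed.

HB.instance Definition _ (T : choiceType) :=
  Choice.copy (withTop T) (can_type (@withTop_optionK T)).

Variable G : oGroupType.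

Definition withTop_le (u v : withTop G) : bool :=
  match u, v with
  | _, Infty => true
  | Infty, _ => false
  | Fin x, Fin y => x <= y
  end.

Fact withTop_le_refl : reflexive withTop_le.
Proof. by case=> /=. Qed.
Fact withTop_le_anti : antisymmetric withTop_le.
Proof. by move=> [x|] [y|] //= /le_anti ->. Qed.
Fact withTop_le_trans : transitive withTop_le.
Proof. by move=> [x|] [y|] [z|] //=; apply: le_trans. Qed.

HB.instance Definition _ := Order.Le_isPOrder.Build ring_display (withTop G)
  withTop_le_refl withTop_le_anti withTop_le_trans.

Fact withTop_le_total : total (<=%R : rel (withTop G)).
Proof. by move=> [x|] [y|] //; apply: og_total. Qed.

HB.instance Definition _ :=
  Order.POrder_isTotal.Build ring_display (withTop G) withTop_le_total.

Fact withTop_lex1 (u : withTop G) : u <= Infty.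
Proof. by case: u. Qed.

HB.instance Definition _ :=
  Order.hasTop.Build ring_display (withTop G) withTop_lex1.

Definition withTop_add (u v : withTop G) : withTop G :=
  match u, v with
  | Fin x, Fin y => Fin (x + y)
  | _, _ => Infty
  end.

Fact withTop_addA : associative withTop_add.
Proof. by move=> [x|] [y|] [z|] //=; rewrite addrA. Qed.
Fact withTop_addC : commutative withTop_add.
Proof. by move=> [x|] [y|] //=; rewrite addrC. Qed.
Fact withTop_add0 : left_id (Fin 0) withTop_add.
Proof. by move=> [x|] //=; rewrite add0r. Qed.

HB.instance Definition _ := GRing.isNmodule.Build (withTop G)
  withTop_addA withTop_addC withTop_add0.

End WithTop.

Variant withBot (T : Type) := BFin of T | NInfty.
Arguments NInfty {T}.

Section WithBot.

Definition withBot_option T (u : withBot T) : option T :=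
  if u is BFin x then Some x else None.
Definition option_withBot T (u : option T) : withBot T :=
  if u is Some x then BFin x else NInfty.
Fact withBot_optionK T : cancel (@withBot_option T) (@option_withBot T).
Proof. by case. Qed.

HB.instance Definition _ (T : choiceType) :=
  Choice.copy (withBot T) (can_type (@withBot_optionK T)).

Variable G : oGroupType.

Definition withBot_le (u v : withBot G) : bool :=
  match u, v with
  | NInfty, _ => true
  | _, NInfty => false
  | BFin x, BFin y => x <= y
  end.

Fact withBot_le_refl : reflexive withBot_le.
Proof. by case=> /=. Qed.
Fact withBot_le_anti : antisymmetric withBot_le.
Proof. by move=> [x|] [y|] //= /le_anti ->. Qed.
Fact withBot_le_trans : transitive withBot_le.
Proof. by move=> [x|] [y|] [z|] //=; apply: le_trans. Qed.

HB.instance Definition _ := Order.Le_isPOrder.Build ring_display (withBot G)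
  withBot_le_refl withBot_le_anti withBot_le_trans.

Fact withBot_le_total : total (<=%R : rel (withBot G)).
Proof. by move=> [x|] [y|] //; apply: og_total. Qed.

HB.instance Definition _ :=
  Order.POrder_isTotal.Build ring_display (withBot G) withBot_le_total.

Fact withBot_le0x (u : withBot G) : NInfty <= u.
Proof. by case: u. Qed.

HB.instance Definition _ :=
  Order.hasBottom.Build ring_display (withBot G) withBot_le0x.

End WithBot.

Record valuation (A : nzRingType) (G : oGroupType) (v : A -> withTop G) : Prop
  := Valuation {
    valM : forall f g, v (f * g) = v f + v g;
    valD : forall f g, Order.min (v f) (v g) <= v (f + g);
    val1 : v 1 = 0;
    val0 : v 0 = Infty }.

Definition trivial_support (A : nzRingType) (G : oGroupType)
  (v : A -> withTop G) : Prop := forall f, v f = Infty -> f = 0.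

Section KeyPolynomials.
Variables (K : fieldType) (G : oGroupType) (nu : {poly K} -> withTop G).
Implicit Types (f p q Q : {poly K}) (r i : nat).

(* (nu f - nu (f^`N(r))) / r; the library's [f^`N(r)] is the r-th Hasse
   derivative, characterized by [nderiv_taylor].  The value is -oo when
   f^`N(r) has infinite value, i.e., for zero support, when f^`N(r) = 0. *)
Definition level_term f r : withBot (divHull G) :=
  match nu f, nu f^`N(r) with
  | Fin x, Fin y => BFin (divq (x - y) r)
  | _, _ => NInfty
  end.

(* f^`N(r) = 0 for r >= size f, so that the maximum is over all r >= 1; only
   meaningful for nonzero f. *)
Definition level f : withBot (divHull G) :=
  \big[Order.max/Order.bottom]_(1 <= r < size f) level_term f r.

Definition key_polynomial Q : Prop :=
  [/\ Q \is monic, (1 < size Q)%N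
    & forall f, f != 0 -> level Q <= level f -> (size Q <= size f)%N].

(* The coefficient of q ^+ i in the q-expansion of p, see [qexpansion]. *)
Definition qdigit q p i : {poly K} := (p %/ q ^+ i) %% q.

Lemma size_qdigit q p i : (1 < size q)%N -> (size (qdigit q p i) < size q)%N.
Proof. by move=> sq; rewrite ltn_modp -size_poly_gt0 (ltn_trans _ sq). Qed.

Lemma qexpansion q p : (1 < size q)%N ->
  p = \sum_(0 <= i < size p) qdigit q p i * q ^+ i.
Proof.
move=> sq; have q0 : q != 0 by rewrite -size_poly_gt0 (ltn_trans _ sq).
have H n : p = \sum_(0 <= i < n) qdigit q p i * q ^+ i
               + (p %/ q ^+ n) * q ^+ n.
  elim: n => [|n IH]; first by rewrite big_geq // add0r expr0 divp1 mulr1.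
  rewrite big_nat_recr //= -addrA {1}IH; congr (_ + _).
  rewrite exprSr -divp_divl mulrA mulrAC -mulrDl addrC.
  by congr (_ * _); rewrite /qdigit -divp_eq.
rewrite {1}(H (size p)) divp_small ?mul0r ?addr0 //.
rewrite -(@prednK (size (q ^+ _))) ?size_poly_gt0 ?expf_neq0 // size_exp ltnS.
by rewrite leq_pmull // -ltnS prednK // (ltn_trans _ sq).
Qed.

(* The digits with index at least size p vanish, and contribute oo. *)
Definition truncation q p : withTop G :=
  \big[Order.min/Order.top]_(0 <= i < size p) nu (qdigit q p i * q ^+ i).

End KeyPolynomials.

Section WellOrder.
Variables (I : Type) (D : I -> Prop) (lt : I -> I -> Prop).

Definition well_ordered : Prop :=
  [/\ forall i, D i -> ~ lt i i,
      forall i j k, D i -> D j -> D k -> lt i j -> lt j k -> lt i k,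
      forall i j, D i -> D j -> [\/ lt i j, i = j | lt j i]
    & forall S : I -> Prop, (exists2 i, D i & S i) ->
      exists i, [/\ D i, S i & forall j, D j -> S j -> ~ lt j i]].

Definition no_last : Prop := forall i, D i -> exists2 j, D j & lt i j.

Definition immediate_succ (i j : I) : Prop :=
  [/\ D j, lt i j & forall k, D k -> lt i k -> ~ lt k j].

End WellOrder.

Section PseudoConvergence.
Variables (I : Type) (D : I -> Prop) (lt : I -> I -> Prop) (G : oGroupType).

Definition pseudo_convergent (L : fieldType) (v : L -> withTop G) (a : I -> L) :
    Prop :=
  [/\ well_ordered D lt, no_last D lt
    & forall i j k, D i -> D j -> D k -> lt i j -> lt j k ->
      v (a j - a i) < v (a k - a j)].

(* V is either the field containing the family or a polynomial ring over it. *)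
Definition pseudo_limit (V : zmodType) (v : V -> withTop G) (a : I -> V)
    (b : V) : Prop :=
  forall i j, D i -> immediate_succ D lt i j -> v (b - a i) = v (a j - a i).

Definition transcendental_type (L : fieldType) (v : L -> withTop G)
    (a : I -> L) : Prop :=
  forall f : {poly L}, exists2 i, D i &
    forall j, D j -> (i = j \/ lt i j) -> v f.[a j] = v f.[a i].

End PseudoConvergence.

Definition level_lt (K : fieldType) (G : oGroupType)
  (nu : {poly K} -> withTop G) (Q Q' : {poly K}) : Prop :=
  level nu Q < level nu Q'.

Definition complete_sequence (K : fieldType) (G : oGroupType)
    (nu : {poly K} -> withTop G) (Lambda : {poly K} -> Prop) : Prop :=
  [/\ forall Q, Lambda Q -> key_polynomial nu Q,
      forall Q Q', Lambda Q -> Lambda Q' -> Q <> Q' -> level nu Q <> level nu Q',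
      well_ordered Lambda (level_lt nu)
    & forall f, exists2 Q, Lambda Q & truncation nu Q f = nu f].

Definition algebraic_closure (K : fieldType) (L : closedFieldType)
  (iota : {rmorphism K -> L}) : Prop := forall a, algebraicOver iota a.

Section Delta.
Variables (K : fieldType) (L : closedFieldType) (iota : {rmorphism K -> L}).
Variables (G : oGroupType) (mu : {poly L} -> withTop G).

Definition roots_in (f : {poly K}) : seq L :=
  sval (closed_field_poly_normal (map_poly iota f)).

Lemma mem_roots_in f a : f != 0 ->
  (a \in roots_in f) = root (map_poly iota f) a.
Proof.
rewrite -(map_poly_eq0 iota) /roots_in; case: closed_field_poly_normal => s /= e.
move=> f0; rewrite e rootZ ?lead_coef_eq0 //.
by rewrite root_prod_XsubC.
Qed.

(* The maximum over the roots of f, which exist for nonconstant f. *)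
Definition delta (f : {poly K}) : withTop G :=
  \big[Order.max/mu ('X - (head 0 (roots_in f))%:P)]_(a <- roots_in f)
    mu ('X - a%:P).

End Delta.

(* Main.v *)
Require Import Defs.
From HB Require Import structures.
From mathcomp Require Import all_boot all_order all_algebra.

Set Implicit Arguments.
Unset Strict Implicit.
Unset Printing Implicit Defensive.

Import Order.TTheory GRing.Theory.
Local Open Scope ring_scope.

(** The level of a polynomial f of K[x] is the largest value mu (x - b) at a
    root b of f.  Indeed f is a constant times a product of factors x - b, and
    its n-th Hasse derivative divided by f is the n-th elementary symmetric
    function of the inverses of these factors.  If g is the largest mu (x - b),
    each product of n inverses has value at least - n g, so that
    (mu f - mu f^`N(n)) / n is at most g ([le_shifted_value]).  For n the number
    of roots with mu (x - b) = g there is exactly one product of value - n g, so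
    that the bound g is attained ([shifted_value_count]).  Consequently
    comparing levels is comparing maximal root values ([level_le]).

    Completeness prevents a single b of the algebraic closure from dominating
    all the a_Q.  Let f in K[x] be nonzero with root b, and Q such that the
    Q-truncation and nu agree at f.  As Q is a key polynomial, all the roots of
    a nonzero digit of the Q-expansion of f, hence of each nonzero term
    p_i Q^i, have value at most mu (x - a_Q).  These terms have value at least
    nu f, so the upper bound above passes to their sum f:
    (mu f - mu f^`N(n)) / n <= mu (x - a_Q) for all n > 0.  As the left-hand
    side attains the maximal root value of f, mu (x - b) <= mu (x - a_Q)
    ([bounds_roots_truncation]).  Since Lambda has no last element, any
    larger Q' satisfies mu (x - b) < mu (x - a_Q').

    The rest is the ultrametric inequality.  The values mu (x - a_Q) increase
    strictly with Q, so mu (a_Q' - a_Q) = mu (x - a_Q) for Q < Q': the family is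
    pseudo-convergent with limit x.  Each b is overtaken by some Q, and from
    there on mu (a_Q' - b) = mu (x - b) is constant; factoring a polynomial
    into linear factors gives the transcendental type.  A limit b of the family
    would satisfy mu (x - b) >= mu (x - a_Q) for all Q, which is excluded. *)

(** * Values with infinity *)

Section WithTopTheory.
Variable G : oGroupType.
Implicit Types (u v w : withTop G) (g h : G).

Lemma og_ltD2r g h k : (g + k < h + k) = (g < h).
Proof.
by rewrite !lt_def (inj_eq (@addIr _ k)) ![_ + k]addrC og_leD2l.
Qed.

Lemma og_ltMn2r n g h : (g *+ n.+1 < h *+ n.+1) = (g < h).
Proof. by rewrite !lt_def og_leMn2r (inj_eq (@og_mulrI _ n)). Qed.

Lemma withTop_ltE g h : (Fin g < Fin h) = (g < h).
Proof. by rewrite !lt_def. Qed.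

Lemma withTop_ltInfty u : (u < Infty) = (u != Infty).
Proof. by case: u => [g|] //; rewrite lt_def. Qed.

Lemma withTop_leD u u' v v' : u <= u' -> v <= v' -> u + v <= u' + v'.
Proof. by move: u u' v v' => [x|] [x'|] [y|] [y'|] //; apply: og_leD. Qed.

Lemma withTop_ltD u u' v v' :
  v != Infty -> u < u' -> v <= v' -> u + v < u' + v'.
Proof.
case: v => [y|] // _; case: u => [x|]; last by rewrite ltNge lex1.
move: u' v' => [x'|] [y'|]; rewrite ?withTop_ltInfty // withTop_ltE => xx' yy'.
rewrite withTop_ltE; apply: (lt_le_trans (y := x' + y)).
  by rewrite og_ltD2r.
exact: og_leD.
Qed.

End WithTopTheory.

(** * Ultrametric inequalities *)

Section ValuationTheory.
Variables (A : nzRingType) (G : oGroupType) (v : A -> withTop G).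
Hypothesis vV : valuation v.
Implicit Types (f g : A) (u w : withTop G).

Lemma valN f : v (- f) = v f.
Proof.
suff vN1 : v (-1) = 0 by rewrite -mulN1r (Defs.valM vV) vN1 add0r.
have := Defs.valM vV (-1) (-1); rewrite mulrNN mul1r (Defs.val1 vV).
case: (v _) => // x [e].
by congr Fin; apply: (@og_mulrI _ 1%N); rewrite /= mul0rn mulr2n -e.
Qed.

Lemma valB f g : Order.min (v f) (v g) <= v (f - g).
Proof. by have := Defs.valD vV f (- g); rewrite valN. Qed.

Lemma valBC f g : v (f - g) = v (g - f).
Proof. by rewrite -valN opprB. Qed.

Lemma le_valD f g u : u <= v f -> u <= v g -> u <= v (f + g).
Proof. by move=> uf ug; apply: le_trans (Defs.valD vV f g); rewrite le_min uf ug. Qed.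

Lemma valD_lt f g : v f < v g -> v (f + g) = v f.
Proof.
move=> fg; apply/le_anti/andP; split; last by rewrite le_valD // ltW.
have := valB (f + g) g; rewrite addrK ge_min => /orP[] // /(lt_le_trans fg).
by rewrite ltxx.
Qed.

Lemma valB_lt f g : v f < v g -> v (f - g) = v f.
Proof. by rewrite -(valN g); apply: valD_lt. Qed.

(** The ultrametric inequality is kept in a form shifted by a common w, because
    subtraction is not available in [withTop]. *)
Lemma le_shift_valD f g u w :
  u <= v f + w -> u <= v g + w -> u <= v (f + g) + w.
Proof.
have := Defs.valD vV f g; rewrite ge_min => /orP[] le_fg hf hg.
  by apply: le_trans hf _; apply: withTop_leD.
by apply: le_trans hg _; apply: withTop_leD.
Qed.

Lemma lt_shift_valD f g u w :
  u < v f + w -> u < v g + w -> u < v (f + g) + w.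
Proof.
have := Defs.valD vV f g; rewrite ge_min => /orP[] le_fg hf hg.
  by apply: lt_le_trans hf _; apply: withTop_leD.
by apply: lt_le_trans hg _; apply: withTop_leD.
Qed.

Lemma shift_valD_lt f g w : v f + w < v g + w -> v (f + g) + w = v f + w.
Proof.
have [/valD_lt -> //|gf] := ltP (v f) (v g).
by rewrite ltNge withTop_leD.
Qed.

Lemma le_shift_val_sum (I : eqType) (r : seq I) (F : I -> A) u w :
    (forall i, i \in r -> u <= v (F i) + w) ->
  u <= v (\sum_(i <- r) F i) + w.
Proof.
move=> uF; rewrite big_seq; elim/big_ind: _ => [|f g|]; last exact: uF.
  by rewrite (Defs.val0 vV) lex1.
exact: le_shift_valD.
Qed.

End ValuationTheory.

(** * Hasse derivatives of products of linear factors *)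

Section HasseDerivatives.
Variables (L : fieldType) (G : oGroupType) (mu : {poly L} -> withTop G).
Hypothesis muV : valuation mu.
Implicit Types (a b c : L) (s : seq L) (f p : {poly L}) (g : G).

(** The factor x - a has no nonzero Hasse derivative of order above 1, so that the
    Leibniz formula reduces to two terms.  This is the induction step for the
    estimates of this section. *)
Lemma nderivnMXsubC n p a :
  (p * ('X - a%:P))^`N(n.+1) = p^`N(n) + p^`N(n.+1) * ('X - a%:P).
Proof.
have := nderivnMXaddC n p 0; rewrite addr0 => eX.
rewrite !mulrBr nderivnB eX addrA; congr (_ - _).
by rewrite ![_ * a%:P]mulrC !mul_polyC nderivnZ.
Qed.

Definition split_poly c s := c *: \prod_(a <- s) ('X - a%:P).

Lemma split_poly_cons c a s :
  split_poly c (a :: s) = split_poly c s * ('X - a%:P).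
Proof. by rewrite /split_poly big_cons -scalerAl mulrC. Qed.

(** The value of the coefficient of index n in the Taylor expansion of f(x + y)
    as a polynomial in y, when y is given the value g. *)
Definition shifted_value g f n := mu f^`N(n) + Fin (g *+ n).

Lemma shifted_value0 g f : shifted_value g f 0 = mu f.
Proof. by rewrite /shifted_value nderivn0 addr0. Qed.

Lemma shifted_value_pred g f n :
  mu f^`N(n) + Fin (g *+ n.+1) = shifted_value g f n + Fin g.
Proof. by rewrite /shifted_value -addrA mulrSr. Qed.

Lemma shifted_value_mul g f a n :
  mu (f^`N(n) * ('X - a%:P)) + Fin (g *+ n) =
  shifted_value g f n + mu ('X - a%:P).
Proof. by rewrite (Defs.valM muV) addrAC. Qed.

(** Each order of derivation costs at most g, as it amounts to summing the products with
    one linear factor removed, and each factor has value at most g. *)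
Lemma le_shifted_value g c s n :
    (forall a, a \in s -> mu ('X - a%:P) <= Fin g) ->
  mu (split_poly c s) <= shifted_value g (split_poly c s) n.
Proof.
elim: s n => [|a s IH] n sg.
  rewrite /split_poly big_nil alg_polyC /shifted_value nderivnC.
  by case: n => [|n] /=; rewrite ?addr0 // (Defs.val0 muV) lex1.
have {IH} IH m := IH m (fun b bs => sg b (mem_behead (s := a :: s) bs)).
case: n => [|n]; first by rewrite shifted_value0.
rewrite split_poly_cons /shifted_value nderivnMXsubC (Defs.valM muV).
apply: (le_shift_valD muV).
  by rewrite shifted_value_pred withTop_leD // sg // mem_head.
by rewrite shifted_value_mul withTop_leD.
Qed.

Hypothesis muX : forall a, mu ('X - a%:P) != Infty.

Lemma val_polyC_fin c : c != 0 -> mu c%:P != Infty.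
Proof.
move=> c0; apply/eqP => muc; have := Defs.valM muV c%:P c^-1%:P.
by rewrite -polyCM mulfV // (Defs.val1 muV) muc.
Qed.

Lemma val_split_poly_fin c s : c != 0 -> mu (split_poly c s) != Infty.
Proof.
move=> c0; elim: s => [|a s IH].
  by rewrite /split_poly big_nil alg_polyC val_polyC_fin.
rewrite split_poly_cons (Defs.valM muV).
by case: (mu _) IH => // x _; case: (mu _) (muX a).
Qed.

(** Among the products obtained by removing n linear factors, the least value
    is reached by removing those of largest value.  When n is the number m of
    factors of value exactly g, there is a single such choice, so that no
    cancellation can occur.  Removing more than m factors costs strictly less
    than g for some of them; this strict part is what makes the other term of
    the Leibniz formula negligible when a factor of value g is added. *)
Lemma shifted_value_count g c s :
    c != 0 -> (forall a, a \in s -> mu ('X - a%:P) <= Fin g) ->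
  let m := count (fun a => mu ('X - a%:P) == Fin g) s in
  mu (split_poly c s) = shifted_value g (split_poly c s) m /\
  forall n, (m < n)%N ->
    mu (split_poly c s) < shifted_value g (split_poly c s) n.
Proof.
move=> c0; elim: s => [|a s IH] sg /=.
  rewrite shifted_value0; split=> // -[//|n] _.
  rewrite /shifted_value /split_poly big_nil alg_polyC nderivnC (Defs.val0 muV).
  by rewrite withTop_ltInfty val_polyC_fin.
have sg' b : b \in s -> mu ('X - b%:P) <= Fin g.
  by move=> bs; rewrite sg // in_cons bs orbT.
have le_f n := le_shifted_value c n sg'.
have [eq_f lt_f] := IH sg'.
have f_fin := val_split_poly_fin s c0; have a_fin := muX a.
have ag := sg a (mem_head _ _).
move: (count _ s) eq_f lt_f => m eq_f lt_f; rewrite split_poly_cons.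
move: (split_poly c s) => f in le_f eq_f lt_f f_fin *.
(* The strict estimate passes to the product as soon as it holds for both
   terms of the Leibniz formula. *)
have step n : 
    mu (f * ('X - a%:P)) < shifted_value g f n + Fin g ->
    mu (f * ('X - a%:P)) < shifted_value g f n.+1 + mu ('X - a%:P) ->
  mu (f * ('X - a%:P)) < shifted_value g (f * ('X - a%:P)) n.+1.
  move=> h1 h2; rewrite /shifted_value nderivnMXsubC; apply: lt_shift_valD => //.
    by rewrite shifted_value_pred.
  by rewrite shifted_value_mul.
(* If the new factor has value g then m increases by one, and the term where
   the new factor is removed has the least value; otherwise m is unchanged,
   and the term where the new factor is kept has the least value. *)
have [ag_eq|ag_ne] := eqVneq (mu ('X - a%:P)) (Fin g).
  rewrite add1n; split.
    rewrite {1}/shifted_value nderivnMXsubC (shift_valD_lt muV).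
      by rewrite shifted_value_pred -eq_f (Defs.valM muV) ag_eq.
    rewrite shifted_value_pred shifted_value_mul ag_eq -eq_f.
    by apply: withTop_ltD => //; apply: lt_f.
  case=> // n; rewrite ltnS => mn; apply: step; rewrite (Defs.valM muV) ag_eq;
    apply: withTop_ltD => //; apply: lt_f => //; exact: leqW.
rewrite add0n.
have {ag_ne}ag_lt : mu ('X - a%:P) < Fin g by rewrite lt_neqAle ag_ne.
have low n : mu (f * ('X - a%:P)) < shifted_value g f n + Fin g.
  by rewrite (Defs.valM muV) addrC [ltRHS]addrC withTop_ltD.
split.
  case: m eq_f lt_f => [|m] eq_f lt_f; first by rewrite shifted_value0.
  rewrite {1}/shifted_value nderivnMXsubC [_ + _ * _]addrC.
  rewrite (shift_valD_lt muV) shifted_value_mul -eq_f -(Defs.valM muV) //.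
  by rewrite shifted_value_pred.
case=> // n mn; apply: step => //.
by rewrite (Defs.valM muV) withTop_ltD // lt_f.
Qed.

End HasseDerivatives.

(** * Levels and truncations in terms of roots *)

Section LevelAndRoots.
Variables (K : fieldType) (L : closedFieldType) (iota : {rmorphism K -> L}).
Variables (Gamma Gamma' : oGroupType).
Variables (j : {additive Gamma -> Gamma'}) (nu : {poly K} -> withTop Gamma).
Variables (mu : {poly L} -> withTop Gamma').
Hypothesis hj : {mono j : x y / x <= y}.
Hypothesis hclos : algebraic_closure iota.
Hypotheses (hnu : valuation nu) (hsupp : trivial_support nu).
Hypothesis hmu : valuation mu.
Hypothesis hext :
  forall f : {poly K}, mu (map_poly iota f) = withTop_map j (nu f).
Implicit Types (f p Q : {poly K}) (b : L) (u : withTop Gamma') (g : Gamma').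

Lemma withTop_map_le (x y : withTop Gamma) :
  (withTop_map j x <= withTop_map j y) = (x <= y).
Proof. by case: x y => [x|] [y|] //; apply: hj. Qed.

(** As b is algebraic over K, x - b divides a nonzero polynomial of K[x], whose
    value is finite because nu has trivial support. *)
Lemma val_XsubC_fin b : mu ('X - b%:P) != Infty.
Proof.
apply/eqP => mub; have [f f0 /factor_theorem[p fE]] := hclos b.
have := hext f; rewrite fE (Defs.valM hmu) mub.
case e: (nu f) => [x|]; first by case: (mu p).
by rewrite (hsupp e) eqxx in f0.
Qed.

Lemma split_polyP f : f != 0 ->
  exists c s, [/\ c != 0, map_poly iota f = split_poly c s &
    forall b, (b \in s) = root (map_poly iota f) b].
Proof.
move=> f0; have [s fE] := closed_field_poly_normal (map_poly iota f).
have c0 : lead_coef (map_poly iota f) != 0 by rewrite lead_coef_eq0 map_poly_eq0.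
exists (lead_coef (map_poly iota f)), s; split=> // b.
by rewrite fE rootZ // root_prod_XsubC.
Qed.

Definition bounds_roots f u :=
  forall b, root (map_poly iota f) b -> mu ('X - b%:P) <= u.

(** For such a b, mu ('X - b%:P) is the maximum [delta iota mu f]. *)
Definition max_root f b :=
  root (map_poly iota f) b /\ bounds_roots f (mu ('X - b%:P)).

Lemma seq_argmax (T : eqType) (F : T -> withTop Gamma') (x : T) (s : seq T) :
  x \in s -> exists2 y, y \in s & forall z, z \in s -> F z <= F y.
Proof.
elim: s x => // y [|z s] IH x _.
  by exists y; rewrite ?mem_head // => w; rewrite inE => /eqP ->.
have [w ws wmax] := IH z (mem_head _ _).
have [le_wy|lt_yw] := leP (F w) (F y).
  exists y; rewrite ?mem_head // => t; rewrite inE => /predU1P[-> //|ts].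
  exact: le_trans (wmax t ts) le_wy.
exists w; first by rewrite inE ws orbT.
by move=> t; rewrite inE => /predU1P[->|/wmax //]; apply: ltW.
Qed.

Lemma max_root_exists f b : f != 0 -> root (map_poly iota f) b ->
  exists b', max_root f b'.
Proof.
move=> f0 fb; have [c [s [c0 fE sE]]] := split_polyP f0.
have [|b' b's b'max] := @seq_argmax _ (fun b => mu ('X - b%:P)) b s.
  by rewrite sE.
by exists b'; split=> [|b'']; rewrite -sE //; apply: b'max.
Qed.

Lemma le_val_nderivn f g n : bounds_roots f (Fin g) ->
  mu (map_poly iota f) <= mu (map_poly iota f)^`N(n) + Fin (g *+ n).
Proof.
move=> fg; have [->|f0] := eqVneq f 0.
  by rewrite rmorph0 linear0 (Defs.val0 hmu).
have [c [s [c0 fE sE]]] := split_polyP f0.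
by rewrite fE le_shifted_value // => b; rewrite sE => /fg.
Qed.

Lemma val_nderivn_attained f b g : f != 0 -> max_root f b ->
    mu ('X - b%:P) = Fin g -> exists2 n, (0 < n)%N &
  mu (map_poly iota f) = mu (map_poly iota f)^`N(n) + Fin (g *+ n).
Proof.
move=> f0 [fb bmax] bg; have [c [s [c0 fE sE]]] := split_polyP f0.
have sg b' : b' \in s -> mu ('X - b'%:P) <= Fin g.
  by rewrite sE -bg; apply: bmax.
have [eq_f _] := shifted_value_count hmu val_XsubC_fin c0 sg.
exists (count (fun b' => mu ('X - b'%:P) == Fin g) s); last by rewrite fE.
by rewrite -has_count; apply/hasP; exists b; rewrite ?sE ?bg.
Qed.

Lemma nu_fin f : f != 0 -> exists x, nu f = Fin x.
Proof.
case e: (nu f) => [x|]; first by exists x.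
by rewrite (hsupp e) eqxx.
Qed.

Lemma val_fin f : f != 0 -> mu (map_poly iota f) != Infty.
Proof. by rewrite hext => /nu_fin[x ->]. Qed.

(** The level of f is the maximal root value g.  The former lies in the
    divisible hull of Gamma and the latter in Gamma', which is why the equality
    is stated through a numerator x and a denominator n. *)
Lemma level_max_root f b g : f != 0 -> max_root f b ->
    mu ('X - b%:P) = Fin g -> exists n x,
  [/\ (0 < n)%N, level nu f = BFin (Defs.divq x n) & j x = g *+ n].
Proof.
move=> f0 fb bg; have [x fx] := nu_fin f0.
have [n n0] := val_nderivn_attained f0 fb bg.
rewrite nderivn_map !hext fx; case fny: (nu f^`N(n)) => [y|] // [jx].
exists n, (x - y); split=> //; last by rewrite raddfB jx addrC addKr.
have n_lt : (n < size f)%N.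
  rewrite ltnNge; apply/negP => /nderivn_poly0 fn0.
  by move: fny; rewrite fn0 (Defs.val0 hnu).
apply/le_anti/andP; split; last first.
  have <- : level_term nu f n = BFin (Defs.divq (x - y) n).
    by rewrite /level_term fx fny.
  by apply: le_bigmax_seq; rewrite ?mem_index_iota ?n0.
rewrite [level _ _]big_seq_cond; apply: bigmax_le => // m.
rewrite andbT mem_index_iota => /andP[m0 _].
rewrite /level_term fx; case fmz: (nu f^`N(m)) => [z|] //.
change (Defs.divq (x - z) m <= Defs.divq (x - y) n).
rewrite divq_leE // -hj !raddfMn /= !raddfB jx [_ + _ - j y]addrC addKr.
have := @le_val_nderivn f g m; rewrite -bg => /(_ fb.2).
rewrite nderivn_map !hext fx fmz.
change (j x <= j z + g *+ m -> (j y + g *+ n - j z) *+ n <= g *+ n *+ m).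
rewrite -jx mulrnAC => xz; apply: og_leMn.
by rewrite -(og_leD2l (j z)) addrC subrK.
Qed.

Lemma level_le f f' b b' :
    f != 0 -> f' != 0 -> max_root f b -> max_root f' b' ->
  (level nu f <= level nu f') = (mu ('X - b%:P) <= mu ('X - b'%:P)).
Proof.
move=> f0 f'0 fb fb'.
case bg: (mu ('X - b%:P)) (val_XsubC_fin b) => [g|] // _.
case bg': (mu ('X - b'%:P)) (val_XsubC_fin b') => [g'|] // _.
have [[|n] [x [n0 -> jx]]] // := level_max_root f0 fb bg.
have [[|n'] [x' [n'0 -> jx']]] // := level_max_root f'0 fb' bg'.
change ((Defs.divq x n.+1 <= Defs.divq x' n'.+1) = (g <= g')).
by rewrite divq_leE // -hj !raddfMn /= jx jx' mulrnAC !og_leMn2r.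
Qed.

(** A root of p with value above that of b would make the level of p exceed that
    of Q, which a key polynomial excludes in degree less than its own. *)
Lemma bounds_roots_key_monomial Q b p i : key_polynomial nu Q -> max_root Q b ->
  p != 0 -> (size p < size Q)%N -> bounds_roots (p * Q ^+ i) (mu ('X - b%:P)).
Proof.
move=> [Qmon _ Qkey] Qb p0 pQ b'; rewrite rmorphM rmorphXn rootM => /orP[pb'|].
  have [c pc] := max_root_exists p0 pb'.
  apply: le_trans (pc.2 _ pb') _; rewrite leNgt; apply/negP => lt_bc.
  move: pQ; rewrite ltnNge Qkey // (level_le (monic_neq0 Qmon) p0 Qb pc).
  exact: ltW.
by rewrite rootE horner_exp expf_eq0 => /andP[_]; apply: Qb.2.
Qed.

(** The terms p_i Q^i of the Q-expansion of f have value at least nu f, because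
    the truncation agrees with nu at f, and their Hasse derivatives of order n
    lose at most n times the value g at b.  Thus those of f lose at most n g as
    well, whereas at some order n > 0 they lose exactly n h, with h the maximal
    root value of f. *)
Lemma bounds_roots_truncation Q b f : key_polynomial nu Q -> max_root Q b ->
  f != 0 -> truncation nu Q f = nu f -> bounds_roots f (mu ('X - b%:P)).
Proof.
move=> Qkey Qb f0 Qf b' fb'; have [c fc] := max_root_exists f0 fb'.
apply: le_trans (fc.2 _ fb') _; rewrite leNgt; apply/negP.
case bg: (mu ('X - b%:P)) (val_XsubC_fin b) => [g|] // _.
case cg: (mu ('X - c%:P)) (val_XsubC_fin c) => [h|] // _; rewrite withTop_ltE.
move=> gh; have [[|n] n0 fE] // := val_nderivn_attained f0 fc cg.
have Q1 : (1 < size Q)%N by case: Qkey.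
have: mu (map_poly iota f) <= mu (map_poly iota f)^`N(n.+1) + Fin (g *+ n.+1).
  rewrite [X in X^`N(_)](_ : _ = \sum_(i <- index_iota 0 (size f))
    map_poly iota (qdigit Q f i * Q ^+ i)); last first.
    by rewrite [in LHS](qexpansion f Q1) rmorph_sum.
  rewrite linear_sum; apply: (le_shift_val_sum hmu) => i i_f.
  have: truncation nu Q f <= nu (qdigit Q f i * Q ^+ i).
    by apply: ge_bigmin_seq.
  rewrite Qf -withTop_map_le -!hext => /le_trans; apply.
  have [->|d0] := eqVneq (qdigit Q f i) 0.
    by rewrite mul0r rmorph0 linear0 (Defs.val0 hmu).
  apply: le_val_nderivn; rewrite -bg.
  by apply: bounds_roots_key_monomial => //; apply: size_qdigit.
(* Since the loss at order n + 1 is exactly (n + 1) h, the bound just proved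
   fails when g < h. *)
rewrite fE leNgt => /negP; apply; rewrite [ltLHS]addrC [ltRHS]addrC.
apply: withTop_ltD => //; last by rewrite withTop_ltE og_ltMn2r.
have := val_fin f0; rewrite fE.
by case: (mu _).
Qed.

Lemma delta_max_root f b : f != 0 -> root (map_poly iota f) b ->
  mu ('X - b%:P) = delta iota mu f -> max_root f b.
Proof.
move=> f0 fb bdelta; split=> // b' fb'.
by rewrite bdelta; apply: le_bigmax_seq; rewrite ?mem_roots_in.
Qed.

End LevelAndRoots.

(** * Families indexed by a well-ordered set *)

Lemma well_ordered_succ (I : Type) (D : I -> Prop) (lt : I -> I -> Prop) i :
  well_ordered D lt -> no_last D lt -> D i -> exists j, immediate_succ D lt i j.
Proof.
move=> [_ _ _ lt_wf] nolast Di; have [k Dk ik] := nolast i Di.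
have [|m [Dm im min_m]] := lt_wf (lt i); first by exists k.
by exists m.
Qed.

Lemma well_ordered_common_bound (I : Type) (D : I -> Prop) (lt : I -> I -> Prop)
    i k : well_ordered D lt -> D i -> D k ->
  exists2 m, D m & forall n, D n -> m = n \/ lt m n ->
    (i = n \/ lt i n) /\ (k = n \/ lt k n).
Proof.
move=> [_ lt_trans lt_total _] Di Dk.
have weaken x y n : D x -> D y -> D n -> lt x y -> y = n \/ lt y n -> lt x n.
  by move=> Dx Dy Dn xy [<-|yn] //; apply: (lt_trans x y n).
have [ik|<-|ki] := lt_total i k Di Dk.
- by exists k => // n Dn kn; split=> //; right; apply: (weaken i k).
- by exists i.
- by exists i => // n Dn i_n; split=> //; right; apply: (weaken k i).
Qed.

(** Over an algebraically closed field every polynomial is a product of linear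
    factors, and eventual constancy of values is stable under products. *)
Lemma transcendental_type_of_linear (I : Type) (D : I -> Prop)
    (lt : I -> I -> Prop) (G : oGroupType) (L : closedFieldType)
    (v : L -> withTop G) (a : I -> L) :
    well_ordered D lt -> (exists i, D i) ->
    (forall x y, v (x * y) = v x + v y) ->
    (forall b, exists2 i, D i & forall k, D k -> i = k \/ lt i k ->
      v (a k - b) = v (a i - b)) ->
  transcendental_type D lt v a.
Proof.
move=> wo [i0 Di0] vM lin f; have [s ->] := closed_field_poly_normal f.
elim: s => [|b s [i Di IH]].
  by exists i0 => // k _ _; rewrite big_nil alg_polyC !hornerC.
have [k Dk linb] := lin b.
have [m Dm m_above] := well_ordered_common_bound wo Di Dk.
exists m => // n Dn mn; rewrite big_cons mulrC scalerAl !hornerM !hornerXsubC !vM.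
have [i_n kn] := m_above n Dn mn; have [im km] := m_above m Dm (or_introl erefl).
by rewrite (IH n) // (IH m) // (linb n) // (linb m).
Qed.

(** * The sequence of optimal roots of the key polynomials *)

Theorem proposition1p2 (K : fieldType) (L : closedFieldType)
    (iota : {rmorphism K -> L}) (Gamma Gamma' : oGroupType)
    (j : {additive Gamma -> Gamma'}) (hj : {mono j : x y / x <= y})
    (nu : {poly K} -> withTop Gamma) (mu : {poly L} -> withTop Gamma')
    (Lambda : {poly K} -> Prop) (a : {poly K} -> L)
    (hclos : algebraic_closure iota)
    (hnu : valuation nu) (hsupp : trivial_support nu)
    (hmu : valuation mu)
    (hext : forall f : {poly K}, mu (map_poly iota f) = withTop_map j (nu f))
    (hLambda : complete_sequence nu Lambda)
    (hnolast : no_last Lambda (level_lt nu))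
    (ha : forall Q, Lambda Q ->
       root (map_poly iota Q) (a Q) /\ mu ('X - (a Q)%:P) = delta iota mu Q) :
  let muL : L -> withTop Gamma' := fun c => mu c%:P in
  [/\ pseudo_convergent Lambda (level_lt nu) muL a,
      transcendental_type Lambda (level_lt nu) muL a,
      ~ (exists b : L, pseudo_limit Lambda (level_lt nu) muL a b)
    & pseudo_limit Lambda (level_lt nu) mu (fun Q => (a Q)%:P) 'X].
Proof.
move=> muL; have [keyL _ woL complL] := hLambda.
have Q0 Q : Lambda Q -> Q != 0 by move=> /(keyL Q)[/monic_neq0].
have maxQ Q : Lambda Q -> max_root iota mu Q (a Q).
  by move=> LQ; have [Qa ad] := ha Q LQ; apply: delta_max_root => //; apply: Q0.
have lt_dist Q Q' : Lambda Q -> Lambda Q' -> level_lt nu Q Q' ->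
    mu ('X - (a Q)%:P) < mu ('X - (a Q')%:P).
  move=> LQ LQ'; rewrite /level_lt !ltNge.
  by rewrite (level_le hj hclos hnu hsupp hmu hext (Q0 _ LQ') (Q0 _ LQ)
    (maxQ _ LQ') (maxQ _ LQ)).
have distE Q Q' : Lambda Q -> Lambda Q' -> level_lt nu Q Q' ->
    mu ((a Q')%:P - (a Q)%:P) = mu ('X - (a Q)%:P).
  move=> LQ LQ' QQ'; rewrite -(valB_lt hmu (lt_dist _ _ LQ LQ' QQ')).
  by congr mu; rewrite opprB [RHS]addrC addrA subrK.
(* The comparison is made strict by passing to a larger element of Lambda. *)
have overtaken b :
    exists2 Q, Lambda Q & mu ('X - b%:P) < mu ('X - (a Q)%:P).
  have [f f0 fb] := hclos b; have [Q LQ Qf] := complL f.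
  have [Q' LQ' QQ'] := hnolast Q LQ; exists Q' => //.
  apply: le_lt_trans (lt_dist _ _ LQ LQ' QQ').
  exact: (bounds_roots_truncation hj hclos hnu hsupp hmu hext (keyL _ LQ)
    (maxQ _ LQ) f0 Qf).
have limX : pseudo_limit Lambda (level_lt nu) mu (fun Q => (a Q)%:P) 'X.
  by move=> Q Q' LQ [LQ' QQ' _]; rewrite distE.
split=> //.
- split=> // Q Q' Q'' LQ LQ' LQ'' QQ' Q'Q''.
  by rewrite /muL !polyCB !distE //; apply: lt_dist.
- apply: transcendental_type_of_linear => //.
  + by have [Q LQ _] := complL 0; exists Q.
  + by move=> x y; rewrite /muL polyCM (Defs.valM hmu).
  move=> b; have [Q LQ bQ] := overtaken b; exists Q => // Q' LQ' le_QQ'.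
  have distb Q'' : Lambda Q'' -> Q = Q'' \/ level_lt nu Q Q'' ->
      muL (a Q'' - b) = mu ('X - b%:P).
    move=> LQ'' le_QQ''; rewrite /muL -(@valB_lt _ _ _ hmu ('X - b%:P) ('X - (a Q'')%:P)).
      by congr mu; rewrite polyCB opprB [RHS]addrC addrA subrK.
    case: le_QQ'' => [<- //|QQ'']; apply: lt_trans bQ _; exact: lt_dist.
  by rewrite !distb //; left.
- move=> [b blim]; have [Q LQ] := overtaken b; rewrite ltNge => /negP; apply.
  have [Q' succQ] := well_ordered_succ woL hnolast LQ.
  have [LQ' QQ' _] := succQ.
  rewrite -[X in X - b%:P](subrK (a Q)%:P) -addrA.
  apply: (le_valD hmu) => //.
  by rewrite (valBC hmu (a Q)%:P) -polyCB -/(muL _) (blim _ _ LQ succQ) /muL polyCB distE.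
Qed.
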